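(* Let $G$ be a metabelian $3$-group with abelianization $G/G'$ of type $(3,3)$. Suppose that $G$ has order $|G|=3^n\ge 3^5$, nilpotency class $c=m-1\ge 3$ (nilpotency index $m\ge 4$), coclass $r=e-1\ge 2$ with CF-invariant $3\le e=n-m+2\le m-1$, and defect of commutativity $0\le k\le 1$. Assume that $G$ is isomorphic to the representative $G_\rho^{m,n}(\alpha,\beta,\gamma,\delta)$ with parameters $\alpha,\beta,\gamma,\delta,\rho\in\{-1,0,1\}$, $m+1\le n\le 2m-3$, and let $x,y$ be the normalized generators of $G$ satisfying the relations of this representative. Put $T(X,Y):=X^2+3X+3+3Y+Y^2$. Then the annihilator $\mathfrak{A}=\mathfrak{A}(G)\unlhd\mathbb{Z}[X,Y]$ is given as follows. (1) If $k=0$, then $$\mathfrak{A}=\mathfrak{R}_{m-2,e-1}:=\left(X^{m-2},\ Y^{e-1},\ XY,\ T(X,Y)\right),$$ independently of the parameters $\alpha,\beta,\gamma,\delta$. (2) If $k=1$, $m\ge 6$ and $e\ge 4$ (that is, $r\ge 3$ and $c\ge 5$), then $$\mathfrak{A}=\mathfrak{S}_{m-2,e-1}(\beta,\delta,\rho):=\left(X^{m-2},\ Y^{e-1}-\rho X^{m-3},\ XY-\rho\delta X^{m-3},\ T(X,Y)+\rho\beta X^{m-3}\right),$$ which depends on $\beta,\delta,\rho$ but is independent of $\alpha,\gamma$. (3) If $k=1$, $m\ge 6$ and $e=3$ (that is, $r=2$ and $c\ge 5$), then $$\mathfrak{A}=\left(X^{m-2},\ Y^2-(1-\beta)\rho X^{m-3},\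 XY-\rho\delta X^{m-3},\ T(X,Y)+\rho\beta X^{m-3}\right).$$
   Context: Conventions: $[a,b]=a^{-1}b^{-1}ab$, $t^g=g^{-1}tg$; $\gamma_j=\gamma_j(G)$ is the lower central series ($\gamma_1=G$, $\gamma_j=[\gamma_{j-1},G]$), $G'=\gamma_2$, $\zeta_j(G)$ the upper central series; $m$ is the index of nilpotency ($\gamma_m=1\ne\gamma_{m-1}$); coclass $r=n-c$. Annihilator: for a finite metabelian group $G=\langle x,y\rangle$ put $s_2=[y,x]$. Conjugation makes $G'$ a $\mathbb{Z}[G]$-module, $t^{ag+bh}=(t^g)^a(t^h)^b$ (so $t^{x-1}=[t,x]$, $t^{y-1}=[t,y]$; the actions of $x,y$ on $G'$ commute). The annihilator (with respect to $x,y$) is the ideal $\mathfrak{A}(G)=\{f\in\mathbb{Z}[X,Y]:s_2^{f(x-1,y-1)}=1\}$. Invariants for $G$ metabelian, $G/G'$ of type $(3,3)$, coclass $\ge 2$: the CF-invariant $e$ is defined by $e+1=\min\{j\ge 3:(\gamma_j:\gamma_{j+1})\le 3\}$; one has $r=e-1$, $e=n-m+2\le m-1$. Put $\chi_j(G)=\{g\in G:[u,g]\in\gamma_{j+2}\ \forall u\in\gamma_j\}$ and $s=\min\{2\le j\le m-1:\chi_j(G)>G'\}$. The defect $k\in\{0,1\}$ is defined by $[\chi_s(G),\gamma_e]=\gamma_{m-k}$. Normalized generators $x,y$ of $G$: $\gamma_3=\langle y^3,x^3,\gamma_4\rangle$, $x\in G\setminus\chi_s(G)$ if $s<m-1$,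 and $y\in\chi_s(G)\setminus G'$. Put $s_2=t_2=[y,x]$; $s_j=[s_{j-1},x]$, $t_j=[t_{j-1},y]$ for $j\ge 3$; $\sigma_3=y^3$, $\tau_3=x^3$; $\sigma_j=[\sigma_{j-1},x]$, $\tau_j=[\tau_{j-1},y]$ for $j\ge 4$. Representative $G_\rho^{m,n}(\alpha,\beta,\gamma,\delta)$ (Nebelung; every such isomorphism class contains one): the group whose normalized generators satisfy - $s_i^3s_{i+1}^3s_{i+2}=1$, $t_i^3t_{i+1}^3t_{i+2}=1$, $\sigma_i^3\sigma_{i+1}^3\sigma_{i+2}=1$, $\tau_i^3\tau_{i+1}^3\tau_{i+2}=1$ for $i\ge 3$; - $s_2^3s_3^3s_4=\tau_4^{-1}$, $t_2^3t_3^3t_4=\sigma_4$; - $[\sigma_j,y]=1$, $[\tau_j,x]=1$ for $j\ge 3$; - $\sigma_i\ne1$ for $3\le i\le m-1$, $\sigma_i=1$ for $i\ge m$; $\tau_j\ne 1$ for $3\le j\le e+k$, $\tau_j=1$ for $j\ge e+k+1$; $\gamma_j=\langle\sigma_j,\tau_j,\gamma_{j+1}\rangle$ with $\gamma_j/\gamma_{j+1}\simeq C_3\times C_3$ for $3\le j\le e$, and $\gamma_j=\langle\sigma_j,\gamma_{j+1}\rangle$ with $\gamma_j/\gamma_{j+1}\simeq C_3$ for $e+1\le j\le m-1$; - $\sigma_i=s_{i-2}^3$, $\tau_i=t_{i-2}^{-3}$, $s_i=\sigma_i^{-1}\sigma_{i+1}^{-1}$, $t_i=\tau_i\tau_{i+1}$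 for $i\ge 5$; - first central relations: $s_2^{(x-1)(y-1)}=[s_3,y]=[t_3,x]=\sigma_{m-1}^{-\rho\delta}$; $\ s_2^3(s_3t_3)^3s_4t_4=\sigma_{m-1}^{\rho\beta}$ (the left side is $s_2^{T(x-1,y-1)}$, $T=X^2+3X+3+3Y+Y^2$); $\ \tau_{e+1}=\sigma_{m-1}^{-\rho}$; $\sigma_{m-1}\in\zeta_1(G)$; - second central relations: $s_4\sigma_4\sigma_5=t_4\tau_4^{-1}\tau_5^{-1}=s_2^{-3}\sigma_4\tau_4^{-1}=\sigma_{m-1}^{\rho\beta}$; $\ s_3\sigma_3\sigma_4=\sigma_{m-2}^{\rho\beta}\sigma_{m-1}^{\gamma}\tau_e^{\delta}$; $\ t_3^{-1}\tau_3\tau_4=\sigma_{m-2}^{\rho\delta}\sigma_{m-1}^{\alpha}\tau_e^{\beta}$. Here $k=0\Leftrightarrow\rho=0$ and $k=1\Leftrightarrow\rho=\pm1$. *)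

(* Defs.v *)
From mathcomp Require Import all_boot all_order all_algebra.
From mathcomp Require Import all_fingroup all_solvable.
From mathcomp Require Export mpoly.

Set Implicit Arguments.
Unset Strict Implicit.
Unset Printing Implicit Defensive.

Import GRing.Theory.
Local Open Scope group_scope.

(* Conventions.  [~ a, b] = a^-1 * b^-1 * a * b and t ^ g = g^-1 * t * g.
   'L_j(G) is the lower central series with 'L_1(G) = G. *)

Notation ZXY := {mpoly int[2]}.

Definition pX : ZXY := 'X_ord0.
Definition pY : ZXY := 'X_ord_max.

Definition ideal_gen (gs : seq ZXY) (f : ZXY) : Prop :=
  exists c : nat -> ZXY, f = (\sum_(i < size gs) c i * gs`_i)%R.

Definition same_ideal (I J : ZXY -> Prop) : Prop := forall f, I f <-> J f.

Definition pT : ZXY := (pX ^+ 2 + 3%:R * pX + 3%:R + 3%:R * pY + pY ^+ 2)%R.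

Definition idealR (mu nu : nat) : ZXY -> Prop :=
  ideal_gen [:: pX ^+ mu; pY ^+ nu; pX * pY; pT]%R.

Definition idealS (mu nu : nat) (beta delta rho : int) : ZXY -> Prop :=
  ideal_gen [:: pX ^+ mu;
                pY ^+ nu - rho *: pX ^+ mu.-1;
                pX * pY - (rho * delta) *: pX ^+ mu.-1;
                pT + (rho * beta) *: pX ^+ mu.-1]%R.

Definition expgz (gT : finGroupType) (g : gT) (z : int) : gT :=
  match z with Posz i => g ^+ i | Negz i => g ^- i.+1 end.

(* iter_comm i g t = [t, g, ..., g] with i entries g, i.e. t^((g-1)^i). *)
Definition iter_comm (gT : finGroupType) (i : nat) (g t : gT) : gT :=
  iter i (fun u => [~ u, g]) t.

(* t^(f(x-1, y-1)), to be used for t in an abelian G' only: there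
   t^(x-1) = t^-1 * t ^ x = [t, x], the actions of x and y commute, and the
   order of the factors does not matter. *)
Definition act_poly (gT : finGroupType) (x y t : gT) (f : ZXY) : gT :=
  \prod_(mu <- msupp f)
     expgz (iter_comm (mu ord_max) y (iter_comm (mu ord0) x t)) f@_mu.

Definition annihilator (gT : finGroupType) (x y : gT) (f : ZXY) : Prop :=
  act_poly x y [~ y, x] f = 1.

Definition is_CF_invariant (gT : finGroupType) (G : {group gT}) (e : nat) :=
  let P j := (3 <= j) && (#|'L_j(G) : 'L_j.+1(G)| <= 3) in
  P e.+1 /\ forall j, P j -> e.+1 <= j.

Definition chi (gT : finGroupType) (G : {group gT}) (j : nat) : {set gT} :=
  [set g in G | [forall u in 'L_j(G), [~ u, g] \in 'L_j.+2(G)]].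

Definition is_s_invariant (gT : finGroupType) (G : {group gT}) (m s : nat) :=
  let P j := [&& 2 <= j, j <= m.-1 & G^`(1) \proper chi G j] in
  P s /\ forall j, P j -> s <= j.

Definition is_defect (gT : finGroupType) (G : {group gT}) (m e s k : nat) :=
  k <= 1 /\ [~: chi G s, 'L_e(G)] = 'L_(m - k)(G).

Record normalized_generators (gT : finGroupType) (G : {group gT})
    (m s : nat) (x y : gT) : Prop := NormalizedGenerators {
  norm_gen : << [set x; y] >> = G :> {set gT};
  norm_gamma3 : 'L_3(G) = << [set y ^+ 3; x ^+ 3] :|: 'L_4(G) >> :> {set gT};
  norm_x : x \in G /\ (s < m.-1 -> x \notin chi G s);
  norm_y : y \in chi G s :\: G^`(1)
}.

(* s_i, t_i are meaningful for i >= 2 and sigma_i, tau_i for i >= 3. *)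
Definition s_ (gT : finGroupType) (x y : gT) i := iter_comm (i - 2) x [~ y, x].
Definition t_ (gT : finGroupType) (x y : gT) i := iter_comm (i - 2) y [~ y, x].
Definition sigma_ (gT : finGroupType) (x y : gT) i := iter_comm (i - 3) x (y ^+ 3).
Definition tau_ (gT : finGroupType) (x y : gT) i := iter_comm (i - 3) y (x ^+ 3).

(* sigma_(m-2) is defined for m >= 5 only.  If m = 4 it occurs below with
   exponents divisible by rho, and then k = 0 (as [chi_s, gamma_3] lies in
   gamma_4 = 1), so that rho = 0. *)
Record representative (gT : finGroupType) (G : {group gT}) (m e k : nat)
    (alpha beta gamma delta rho : int) (x y : gT) : Prop := Representative {
  rep_defect : (k = 0 <-> rho = 0%R) /\
               (k = 1%N <-> rho = 1%R \/ rho = (-1)%R);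
  rep_s3 : forall i, 3 <= i ->
    s_ x y i ^+ 3 * s_ x y i.+1 ^+ 3 * s_ x y i.+2 = 1;
  rep_t3 : forall i, 3 <= i ->
    t_ x y i ^+ 3 * t_ x y i.+1 ^+ 3 * t_ x y i.+2 = 1;
  rep_sigma3 : forall i, 3 <= i ->
    sigma_ x y i ^+ 3 * sigma_ x y i.+1 ^+ 3 * sigma_ x y i.+2 = 1;
  rep_tau3 : forall i, 3 <= i ->
    tau_ x y i ^+ 3 * tau_ x y i.+1 ^+ 3 * tau_ x y i.+2 = 1;
  rep_s2 : s_ x y 2 ^+ 3 * s_ x y 3 ^+ 3 * s_ x y 4 = (tau_ x y 4)^-1;
  rep_t2 : t_ x y 2 ^+ 3 * t_ x y 3 ^+ 3 * t_ x y 4 = sigma_ x y 4;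
  rep_sigma_y : forall j, 3 <= j -> [~ sigma_ x y j, y] = 1;
  rep_tau_x : forall j, 3 <= j -> [~ tau_ x y j, x] = 1;
  rep_sigma_neq1 : forall i, 3 <= i <= m.-1 -> sigma_ x y i != 1;
  rep_sigma_eq1 : forall i, m <= i -> sigma_ x y i = 1;
  rep_tau_neq1 : forall j, 3 <= j <= e + k -> tau_ x y j != 1;
  rep_tau_eq1 : forall j, (e + k).+1 <= j -> tau_ x y j = 1;
  rep_bicyclic : forall j, 3 <= j <= e ->
    'L_j(G) = << [set sigma_ x y j; tau_ x y j] :|: 'L_j.+1(G) >> :> {set gT}
    /\ abelian_type ('L_j(G) / 'L_j.+1(G)) = [:: 3; 3];
  rep_cyclic : forall j, e.+1 <= j <= m.-1 ->
    'L_j(G) = << sigma_ x y j |: 'L_j.+1(G) >> :> {set gT}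
    /\ abelian_type ('L_j(G) / 'L_j.+1(G)) = [:: 3];
  rep_sigma_s : forall i, 5 <= i -> sigma_ x y i = s_ x y (i - 2) ^+ 3;
  rep_tau_t : forall i, 5 <= i -> tau_ x y i = t_ x y (i - 2) ^- 3;
  rep_s_sigma : forall i, 5 <= i ->
    s_ x y i = (sigma_ x y i)^-1 * (sigma_ x y i.+1)^-1;
  rep_t_tau : forall i, 5 <= i -> t_ x y i = tau_ x y i * tau_ x y i.+1;
  rep_XY : let z := expgz (sigma_ x y m.-1) (- (rho * delta)) in
    [/\ act_poly x y (s_ x y 2) (pX * pY)%R = z,
        [~ s_ x y 3, y] = z & [~ t_ x y 3, x] = z];
  rep_T :
    s_ x y 2 ^+ 3 * (s_ x y 3 * t_ x y 3) ^+ 3 * s_ x y 4 * t_ x y 4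
    = expgz (sigma_ x y m.-1) (rho * beta)%R;
  rep_tau : tau_ x y e.+1 = expgz (sigma_ x y m.-1) (- rho);
  rep_central : sigma_ x y m.-1 \in 'Z(G);
  rep_second : let z := expgz (sigma_ x y m.-1) (rho * beta)%R in
    [/\ s_ x y 4 * sigma_ x y 4 * sigma_ x y 5 = z,
        t_ x y 4 * (tau_ x y 4)^-1 * (tau_ x y 5)^-1 = z
      & s_ x y 2 ^- 3 * sigma_ x y 4 * (tau_ x y 4)^-1 = z];
  rep_gamma :
    s_ x y 3 * sigma_ x y 3 * sigma_ x y 4
    = expgz (sigma_ x y (m - 2)) (rho * beta)%R
      * expgz (sigma_ x y m.-1) gamma * expgz (tau_ x y e) delta;
  rep_alpha :
    (t_ x y 3)^-1 * tau_ x y 3 * tau_ x y 4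
    = expgz (sigma_ x y (m - 2)) (rho * delta)%R
      * expgz (sigma_ x y m.-1) alpha * expgz (tau_ x y e) beta
}.

(* Main.v *)
From HB Require Import structures.
Require Import Defs.
From mathcomp Require Import all_boot all_order all_algebra.
From mathcomp Require Import all_fingroup all_solvable.
From mathcomp Require Import ring zify ssrcomplements.

Set Implicit Arguments.
Unset Strict Implicit.
Unset Printing Implicit Defensive.

Import GRing.Theory.
Local Open Scope group_scope.

(** Let a be s_2 = [y, x], seen in the derived subgroup G' written additively,
    and let X and Y act on G' by u |-> [u, x] and u |-> [u, y].  The two actions
    commute because G' is abelian, so G' is a Z[X,Y]-module, and the annihilator
    of the theorem is the kernel of the evaluation f |-> a f.

    Every case of the theorem concerns an ideal of one form,
      I = (X^mu, Y^nu - A p, XY - B p, T + C p)   with p = X^(mu-1),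
    where mu = m - 2, nu = e - 1, B = rho delta, C = rho beta, and A is rho or
    (1 - beta) rho.  The relations of the representative say that its four
    generators kill a (representative_annihilated): a p is the inverse of
    sigma_(m-1) if m >= 6, while for k = 0 no multiple of p occurs; a (XY) and
    a T are given multiples of sigma_(m-1), and a Y^nu is t_(e+1), which equals
    tau_(e+1) for e >= 4 and picks up the further summand rho beta sigma_(m-1)
    for e = 3; this is where the factor 1 - beta comes from.

    Conversely Z[X,Y]/I has at most 3^(mu+nu-1) elements.  It is spanned by
    1, Y, ..., Y^(nu-1), X, ..., X^(mu-1), since XY falls into the socle spanned
    by p; and multiplying T + C p by one of these monomials expresses 3 times
    the monomial by later ones.  So every polynomial has a normal form modulo I
    with coefficients 0, 1, 2 (ternary_expansion, chain_normal_basis).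

    Finally a generates the module G' (pact_onto), because modulo the normal
    closure of [y, x] the generators x and y of G commute, and the order of G'
    is 3^(n-2) = 3^(mu+nu-1).  So the evaluation is injective on normal forms,
    and its kernel is I (ternary_kernel, annihilator_presentation).

    The ideal determines beta, delta and rho: two candidate generators that are
    both annihilated differ by a multiple of p, and a p has order exactly 3
    (socle_coef_dvd3). *)

(** * Evaluating a polynomial at two commuting endomorphisms *)

Section PolynomialAction.
Local Open Scope ring_scope.

Variables (M : zmodType) (DX DY : {additive M -> M}).
Hypothesis DXY : forall u, DX (DY u) = DY (DX u).
Implicit Types (u : M) (f g : ZXY).

Definition mono_act (mu : 'X_{1..2}) u :=
  iter (mu ord_max) DY (iter (mu ord0) DX u).

(** The value f(DX, DY) u, as a sum over the support of f to match term by term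
    the product in a nonabelian group that it will be compared with. *)
Definition pact u f := \sum_(mu <- msupp f) mono_act mu u *~ f@_mu.

(** Supports of different polynomials differ, so additivity in f is proved on a
    common finite range of monomials. *)
Lemma pactE u k f : (msize f <= k)%N ->
  pact u f = \sum_(mu : 'X_{1..2 < k}) mono_act mu u *~ f@_mu.
Proof.
pose I : subFinType _ := 'X_{1..2 < k}.
move=> le_fk; rewrite /pact (big_mksub I) //=; first last.
- by move=> mu /msize_mdeg_lt /leq_trans; apply.
- by rewrite msupp_uniq.
rewrite big_rmcond //= => i; rewrite -mcoeff_eq0 => /eqP ->.
by rewrite mulr0z.
Qed.

Lemma pact_is_additive u : zmod_morphism (pact u).
Proof.
move=> f g; pose k := maxn (msize (f - g)) (maxn (msize f) (msize g)).
rewrite !(@pactE u k) ?leq_max ?leqnn ?orbT // -sumrB.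
by apply: eq_bigr => mu _; rewrite mcoeffB mulrzBr.
Qed.

HB.instance Definition _ u :=
  GRing.isZmodMorphism.Build ZXY M (pact u) (pact_is_additive u).

Lemma pactZ u (c : int) f : pact u (c *: f) = pact u f *~ c.
Proof. by rewrite -[c in LHS]intz scaler_int raddfMz. Qed.

Lemma pactXm u mu : pact u 'X_[mu] = mono_act mu u.
Proof. by rewrite /pact msuppX big_seq1 mcoeffX eqxx mulr1z. Qed.

Lemma mono_actD mu nu u : mono_act (mu + nu) u = mono_act mu (mono_act nu u).
Proof.
rewrite /mono_act !mnmDE !iterD; congr iter.
move: (mu ord0) (nu ord_max) => i j.
have DXiY v : iter i DX (DY v) = DY (iter i DX v) by elim: i => //= i ->.
by elim: j => //= j ->; rewrite DXiY.
Qed.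

Lemma mono_act_is_additive mu : zmod_morphism (mono_act mu).
Proof.
rewrite /mono_act => u v.
have itB (D : {additive M -> M}) i w w' :
  iter i D (w - w') = iter i D w - iter i D w'.
  by elim: i => //= i ->; rewrite raddfB.
by rewrite !itB.
Qed.

HB.instance Definition _ mu :=
  GRing.isZmodMorphism.Build M M (mono_act mu) (mono_act_is_additive mu).

Lemma pactM u f g : pact u (f * g) = pact (pact u g) f.
Proof.
have monoM mu : pact u ('X_[mu] * g) = mono_act mu (pact u g).
  rewrite [g in LHS]mpolyE mulr_sumr !raddf_sum /=; apply: eq_bigr => nu _.
  rewrite -scalerAr -mpolyXD pactZ pactXm mono_actD; exact/esym/raddfMz.
rewrite [f in LHS]mpolyE mulr_suml raddf_sum; apply: eq_bigr => mu _.
by rewrite /= -scalerAl pactZ monoM.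
Qed.

Lemma pact_pX u : pact u pX = DX u.
Proof. by rewrite pactXm /mono_act !mnm1E. Qed.

Lemma pact_pY u : pact u pY = DY u.
Proof. by rewrite pactXm /mono_act !mnm1E. Qed.

Lemma pact1 u : pact u 1 = u.
Proof. by rewrite -mpolyX0 pactXm /mono_act !mnm0E. Qed.

Lemma pact_pXn u i : pact u (pX ^+ i) = iter i DX u.
Proof. by elim: i => [|i IHi]; rewrite ?pact1 // exprS pactM pact_pX IHi. Qed.

Lemma pact_pYn u i : pact u (pY ^+ i) = iter i DY u.
Proof. by elim: i => [|i IHi]; rewrite ?pact1 // exprS pactM pact_pY IHi. Qed.

Lemma pact0r f : pact 0 f = 0.
Proof.
by rewrite /pact big1 // => mu _; rewrite (raddf0 (mono_act mu)) mul0rz.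
Qed.

End PolynomialAction.

(** * Ternary digits along a chain of subgroups *)

Section TernaryDigits.
Local Open Scope ring_scope.

Variables (V : zmodType) (I : V -> Prop).
Hypothesis I0 : I 0.
Hypothesis IB : forall u v, I u -> I v -> I (u - v).
Implicit Types (u v : V) (vs : seq V) (ds : seq 'I_3).

(** Membership in I + Zv_1 + ... + Zv_k, by recursion on the list so that the
    spans of its tails form a descending chain of subgroups ending in I. *)
Fixpoint span_mod vs u : Prop :=
  if vs is v :: vs' then exists c : int, span_mod vs' (u - v *~ c) else I u.

(** Each successive quotient of the chain of spans has order 1 or 3. *)
Fixpoint ternary_chain vs : Prop :=
  if vs is v :: vs' then span_mod vs' (v *+ 3) /\ ternary_chain vs' else True.

Definition digit_sum vs ds := \sum_(p <- zip vs ds) p.1 *+ p.2.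

Lemma span_mod_ideal vs u : I u -> span_mod vs u.
Proof.
by elim: vs => //= v vs IHvs Iu; exists 0; rewrite subr0; apply: IHvs.
Qed.

Lemma span_modB vs u v : span_mod vs u -> span_mod vs v -> span_mod vs (u - v).
Proof.
elim: vs u v => [|w vs IHvs] u v; first exact: IB.
move=> [c spu] [d spv]; exists (c - d).
have -> : u - v - w *~ (c - d) = (u - w *~ c) - (v - w *~ d).
  by rewrite mulrzBr !opprB [_ *~ d - v]addrC [RHS]addrACA [- _ + _ *~ d]addrC.
exact: IHvs.
Qed.

Lemma span_modD vs u v : span_mod vs u -> span_mod vs v -> span_mod vs (u + v).
Proof.
move=> spu spv; rewrite -[v]opprK -[- v]sub0r; apply: span_modB => //.
by apply: span_modB => //; apply: span_mod_ideal.
Qed.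

Lemma span_modMz vs u c : span_mod vs u -> span_mod vs (u *~ c).
Proof.
move=> spu; have sp0 : span_mod vs 0 by apply: span_mod_ideal.
have spn n : span_mod vs (u *+ n).
  by elim: n => [|n IHn]; rewrite ?mulr0n ?mulrS //; apply: span_modD.
case: c => n; first exact: spn.
rewrite NegzE mulrNz -sub0r; apply: span_modB => //; exact: spn.
Qed.

Lemma span_mod_mem vs u : u \in vs -> span_mod vs u.
Proof.
elim: vs => //= v vs IHvs; rewrite inE; case: eqP => [-> _ | _ /= vs_u].
  by exists 1; rewrite subrr; apply: span_mod_ideal.
by exists 0; rewrite subr0; apply: IHvs.
Qed.

(** Divide the first coefficient by 3: the remainder is its digit, and the
    quotient is carried into the span of the tail, which contains 3v. *)
Lemma ternary_expansion vs u : ternary_chain vs -> span_mod vs u ->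
  exists2 ds, size ds = size vs & I (u - digit_sum vs ds).
Proof.
elim: vs u => [|v vs IHvs] u.
  by exists [::]; rewrite // /digit_sum big_nil subr0.
case=> sp3v chain_vs [c spu].
have lt_r3 : (`|(c %% 3)%Z| < 3)%N by lia.
pose d := Ordinal lt_r3.
have [||ds sz_ds Iu] := IHvs (u - v *+ d); first by [].
  have ->: u - v *+ d = (u - v *~ c) + v *+ 3 *~ (c %/ 3)%Z.
    rewrite -!addrA; congr (_ + _); rewrite -[v *+ 3]/(v *~ 3) -mulrzA -mulrNz.
    rewrite -mulrzDr -[v *+ d]/(v *~ d) -mulrNz; congr (v *~ _).
    rewrite /=; lia.
  by apply: span_modD => //; apply: span_modMz.
exists (d :: ds); first by rewrite /= sz_ds.
by rewrite /digit_sum /= big_cons opprD addrA.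
Qed.

(** There are only 3 ^ size vs digit sums, and they represent all classes
    modulo I; so a map onto a set of that order, constant on the classes,
    separates them. *)
Lemma ternary_kernel (T : finType) (phi : V -> T) vs :
    ternary_chain vs -> (forall u, span_mod vs u) ->
    (forall t, exists u, phi u = t) ->
    (forall u v, I (u - v) -> phi u = phi v) ->
    #|T| = (3 ^ size vs)%N ->
  forall u, phi u = phi 0 -> I u.
Proof.
move=> chain_vs span_vs phi_onto phi_I cardT.
pose psi (ds : (size vs).-tuple 'I_3) := phi (digit_sum vs ds).
have rep u : exists2 ds : (size vs).-tuple 'I_3,
    I (u - digit_sum vs ds) & psi ds = phi u.
  have [ds sz_ds Iu] := ternary_expansion chain_vs (span_vs u).
  by exists (Tuple (introT eqP sz_ds)) => //; apply/esym/phi_I.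
have inj_psi : injective psi.
  apply/injectiveP/card_uniqP.
  rewrite size_map -cardE card_tuple card_ord -cardT.
  apply/eqP; rewrite -[_ == _]/(#|_| == #|T|); apply/eqP/eq_card => t.
  have [u <-] := phi_onto t; have [ds _ <-] := rep u.
  by rewrite inE; apply/codomP; exists ds.
pose d0 : (size vs).-tuple 'I_3 := nseq_tuple (size vs) ord0.
have dig0 : digit_sum vs d0 = 0.
  rewrite /digit_sum big_seq big1 // => -[v d] /= /(map_f snd).
  rewrite /= -/unzip2 unzip2_zip; last by rewrite size_nseq.
  by case/nseqP => ->; rewrite mulr0n.
move=> u phi_u; have [ds Iu psi_ds] := rep u.
suff ds0 : ds = d0 by move: Iu; rewrite ds0 dig0 subr0.
by apply: inj_psi; rewrite psi_ds phi_u /psi dig0.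
Qed.

End TernaryDigits.

(** * The ideal of the presentation *)

Section IdealGenerators.
Local Open Scope ring_scope.
Implicit Types (gs : seq ZXY) (f g : ZXY).

Lemma ideal_gen_mem gs g : g \in gs -> ideal_gen gs g.
Proof.
move=> gs_g; have lt_i : (index g gs < size gs)%N by rewrite index_mem.
exists (fun i => (i == index g gs)%:R).
rewrite (bigD1 (Ordinal lt_i)) //= eqxx mul1r nth_index // big1 ?addr0 // => i.
by rewrite -val_eqE /= => /negbTE ->; rewrite mul0r.
Qed.

Lemma ideal_gen0 gs : ideal_gen gs 0.
Proof. by exists (fun _ => 0); rewrite big1 // => i _; rewrite mul0r. Qed.

Lemma ideal_genD gs f g :
  ideal_gen gs f -> ideal_gen gs g -> ideal_gen gs (f + g).
Proof.
move=> [c ->] [d ->]; exists (fun i => c i + d i); rewrite -big_split /=.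
by apply: eq_bigr => i _; rewrite mulrDl.
Qed.

Lemma ideal_genM gs f g : ideal_gen gs g -> ideal_gen gs (f * g).
Proof.
move=> [c ->]; exists (fun i => f * c i); rewrite mulr_sumr.
by apply: eq_bigr => i _; rewrite mulrA.
Qed.

Lemma ideal_genB gs f g :
  ideal_gen gs f -> ideal_gen gs g -> ideal_gen gs (f - g).
Proof.
by move=> If Ig; rewrite -mulN1r; apply/ideal_genD/ideal_genM.
Qed.

Lemma ideal_gen_sub_kernel gs (M : zmodType) (phi : {additive ZXY -> M}) f :
    (forall g h, phi g = 0 -> phi (h * g) = 0) ->
    {in gs, forall g, phi g = 0} -> ideal_gen gs f -> phi f = 0.
Proof.
move=> phiM phi0 [c ->]; rewrite raddf_sum big1 // => i _.
by apply/phiM/phi0/mem_nth.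
Qed.

End IdealGenerators.

Section NormalForm.
Local Open Scope ring_scope.

Variables (V : comNzRingType) (I : V -> Prop).
Hypotheses (I0 : I 0) (IB : forall f g, I f -> I g -> I (f - g)).
Hypothesis IM : forall f g, I g -> I (f * g).

Variables (X Y : V) (mu nu : nat) (a b c : int).
Hypotheses (mu_gt1 : (1 < mu)%N).

Local Notation p := (X ^+ mu.-1).
Hypotheses (I_X : I (X ^+ mu)) (I_Y : I (Y ^+ nu - p *~ a)).
Hypotheses (I_XY : I (X * Y - p *~ b)) (I_socle : I (p * Y)).
Hypothesis I_T :
  I (X ^+ 2 + 3%:R * X + 3%:R + 3%:R * Y + Y ^+ 2 + p *~ c).

Definition Xpowers i := [seq X ^+ j | j <- iota i (mu - i)].
Definition normal_basis j := [seq Y ^+ i | i <- iota j (nu - j)] ++ Xpowers 1.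

Local Notation span := (span_mod I).

Let ID f g : I f -> I g -> I (f + g).
Proof. by move=> If Ig; rewrite -[g]opprK -[- g]sub0r; apply/IB/IB. Qed.
Let spanI vs f : I f -> span vs f.
Proof. exact: span_mod_ideal. Qed.
Let spanD vs f g : span vs f -> span vs g -> span vs (f + g).
Proof. by apply: span_modD; [apply: I0 | apply: IB]. Qed.
Let spanMz vs f z : span vs f -> span vs (f *~ z).
Proof. by apply: span_modMz; [apply: I0 | apply: IB]. Qed.
Let span_mem vs f : f \in vs -> span vs f.
Proof. exact/span_mod_mem/I0. Qed.

Lemma span_Xn i j : (i <= j)%N -> span (Xpowers i) (X ^+ j).
Proof.
move=> le_ij; case: (ltnP j mu) => [lt_j|le_j].
  by apply/span_mem/map_f; rewrite mem_iota; lia.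
by rewrite -(subnK le_j) exprD; apply/spanI/IM.
Qed.

Lemma XnYE i :
  X ^+ i.+1 * Y = X ^+ i * (X * Y - p *~ b) + X ^+ (i + mu.-1) *~ b.
Proof. rewrite exprS exprD; ring. Qed.

(** Multiplying by Y moves X ^ i up to the socle, hence deeper in the chain;
    when X ^ i already lies in the socle, the product vanishes. *)
Lemma span_XnY i : (0 < i)%N -> span (Xpowers i.+1) (X ^+ i * Y).
Proof.
case: i => // i _; case: (ltnP i.+1 mu.-1) => [lt_i|le_i]; last first.
  by rewrite -(subnK le_i) exprD -mulrA; apply/spanI/IM.
rewrite XnYE; apply: spanD; first exact/spanI/IM.
by apply/spanMz/span_Xn; lia.
Qed.

(** X Y is congruent to a multiple of p, and Y kills p modulo I. *)
Lemma ideal_XnYn i j : (0 < i)%N -> (1 < j)%N -> I (X ^+ i * Y ^+ j).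
Proof.
case: i j => // i [|[|j]] // _ _.
have ->: X ^+ i.+1 * Y ^+ j.+2 =
         X ^+ i * Y ^+ j.+1 * (X * Y - p *~ b)
         + b%:~R * X ^+ i * Y ^+ j * (p * Y).
  rewrite !exprS; ring.
by apply: ID; apply: IM.
Qed.

(** X ^ i T has the term 3 X ^ i; its other terms lie deeper in the chain. *)
Lemma chain_Xpowers i : (0 < i)%N -> ternary_chain I (Xpowers i).
Proof.
move Dn : (mu - i)%N => n.
elim: n => [|n IHn] in i Dn *; rewrite /Xpowers Dn //=.
move=> i_gt0; have Dn' : n = (mu - i.+1)%N by lia.
split; last by have:= IHn i.+1; rewrite /Xpowers -Dn'; apply.
rewrite Dn' -/(Xpowers i.+1).
have ->: X ^+ i *+ 3 =
     X ^+ i * (X ^+ 2 + 3%:R * X + 3%:R + 3%:R * Y + Y ^+ 2 + p *~ c)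
   + (X ^+ i.+1 *~ (-3) + (X ^+ i.+2 *~ -1 + ((X ^+ i * Y) *~ (-3)
   + ((X ^+ i * Y ^+ 2) *~ -1 + X ^+ (i + mu.-1) *~ (- c))))).
  rewrite !exprS exprD; ring.
apply: spanD; first exact/spanI/IM.
apply: spanD; first exact/spanMz/span_Xn.
apply: spanD; first exact/spanMz/span_Xn.
apply: spanD; first exact/spanMz/span_XnY.
apply: spanD; first exact/spanMz/spanI/ideal_XnYn.
by apply/spanMz/span_Xn; lia.
Qed.

Lemma span_cat us vs f : span vs f -> span (us ++ vs) f.
Proof.
by elim: us => //= u us IHus spf; exists 0; rewrite mulr0z subr0; apply: IHus.
Qed.

Lemma span_XnYn i j k : (0 < i)%N -> span (normal_basis k) (X ^+ i * Y ^+ j).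
Proof.
case: i => // i _; apply: span_cat.
case: j => [|[|j]]; last exact/spanI/ideal_XnYn.
  by rewrite mulr1; apply: span_Xn.
rewrite XnYE; apply: spanD; first exact/spanI/IM.
by apply/spanMz/span_Xn; lia.
Qed.

Lemma span_Yn j k : (k <= j)%N -> span (normal_basis k) (Y ^+ j).
Proof.
move=> le_kj; case: (ltnP j nu) => [lt_j|le_j].
  by apply/span_mem; rewrite mem_cat map_f // mem_iota; lia.
have ->: Y ^+ j = Y ^+ (j - nu) * (Y ^+ nu - p *~ a)
    + (p * Y ^+ (j - nu)) *~ a.
  by rewrite -[in LHS](subnK le_j) exprD; ring.
apply: spanD; first exact/spanI/IM.
by apply/spanMz/span_XnYn; lia.
Qed.

(** Y ^ k T has the term 3 Y ^ k, and its other terms lie deeper in the chain: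
    the powers of Y come before the powers of X because Y ^ nu and the mixed
    monomials reduce to multiples of powers of X. *)
Lemma chain_normal_basis k : ternary_chain I (normal_basis k).
Proof.
move Dn : (nu - k)%N => n.
elim: n => [|n IHn] in k Dn *; rewrite /normal_basis Dn /=.
  exact: chain_Xpowers.
have Dn' : n = (nu - k.+1)%N by lia.
split; last by have:= IHn k.+1; rewrite /normal_basis -Dn'; apply.
rewrite Dn' -/(normal_basis k.+1).
have ->: Y ^+ k *+ 3 =
     Y ^+ k * (X ^+ 2 + 3%:R * X + 3%:R + 3%:R * Y + Y ^+ 2 + p *~ c)
   + (Y ^+ k.+1 *~ (-3) + (Y ^+ k.+2 *~ -1 + ((X ^+ 1 * Y ^+ k) *~ (-3)
   + ((X ^+ 2 * Y ^+ k) *~ -1 + (p * Y ^+ k) *~ (- c))))).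
  rewrite !exprS; ring.
apply: spanD; first exact/spanI/IM.
apply: spanD; first exact/spanMz/span_Yn.
apply: spanD; first exact/spanMz/span_Yn.
apply: spanD; first exact/spanMz/span_XnYn.
apply: spanD; first exact/spanMz/span_XnYn.
by apply/spanMz/span_XnYn; lia.
Qed.

Lemma size_normal_basis : size (normal_basis 0) = (mu + nu).-1.
Proof. rewrite size_cat !size_map !size_iota; lia. Qed.

End NormalForm.

(** * The derived subgroup as a module over the polynomial ring *)

Section CommutatorModule.

Import FiniteModule.

Variables (gT : finGroupType) (G : {group gT}) (x y : gT).
Hypotheses (abG' : abelian G^`(1)) (defG : <<[set x; y]>> = G :> {set gT}).
Local Notation M := (fmod_of abG').
Local Notation fmod := (fmod abG').

Definition comm_act (g : gT) (u : M) : M := (u ^@ g - u)%R.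

Lemma comm_act_is_additive g : zmod_morphism (comm_act g).
Proof.
move=> u v; rewrite /comm_act actAr actNr opprD opprK addrACA opprB.
by rewrite [(v - _)%R]addrC.
Qed.

HB.instance Definition _ g :=
  GRing.isZmodMorphism.Build M M (comm_act g) (comm_act_is_additive g).

Let Gx : x \in G. Proof. by rewrite -defG mem_gen ?set21. Qed.
Let Gy : y \in G. Proof. by rewrite -defG mem_gen ?set22. Qed.
Let nG' g : g \in G -> g \in 'N(G^`(1)).
Proof. exact/subsetP/normal_norm/der_normal. Qed.

(** x y and y x differ by a commutator, which acts trivially on the abelian
    group G'. *)
Lemma comm_actC u : comm_act x (comm_act y u) = comm_act y (comm_act x u).
Proof.
have [nx ny nxy] := And3 (nG' Gx) (nG' Gy) (nG' (groupR Gy Gx)).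
have actXY : (u ^@ y ^@ x = u ^@ x ^@ y)%R.
  have cG' : [~ y, x] \in G^`(1) by rewrite mem_commg.
  rewrite -!actrM // commgC [LHS]actrM ?groupM ?groupV //.
  apply: val_inj; rewrite fmvalJ // conjgE.
  by rewrite (centsP abG' _ (fmodP _) _ cG') mulKg.
rewrite /comm_act !actAr !actNr actXY !opprD !opprK -!addrA; congr (_ + _)%R.
exact: addrCA.
Qed.

Lemma fmod_comm t g : t \in G^`(1) -> g \in G ->
  fmod [~ t, g] = comm_act g (fmod t).
Proof.
move=> G't Gg; rewrite /comm_act -fmodJ ?nG' // addrC -fmodV -fmodM ?groupV //.
by rewrite memJ_norm // nG'.
Qed.

Lemma mem_comm t g : t \in G^`(1) -> g \in G -> [~ t, g] \in G^`(1).
Proof. by move=> G't Gg; rewrite groupMl ?groupV // memJ_norm // nG'. Qed.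

Lemma mem_iter_comm i t g :
  t \in G^`(1) -> g \in G -> iter_comm i g t \in G^`(1).
Proof. by move=> G't Gg; elim: i => //= i IHi; apply: mem_comm. Qed.

Lemma fmod_iter_comm i t g : t \in G^`(1) -> g \in G ->
  fmod (iter_comm i g t) = iter i (comm_act g) (fmod t).
Proof.
move=> G't Gg; elim: i => //= i <-.
by rewrite fmod_comm //; apply: mem_iter_comm.
Qed.

Lemma mem_expgz t z : t \in G^`(1) -> expgz t z \in G^`(1).
Proof. by move=> G't; case: z => i /=; rewrite ?groupV groupX. Qed.

Lemma fmod_expgz t z : t \in G^`(1) -> fmod (expgz t z) = (fmod t *~ z)%R.
Proof.
by move=> G't; case: z => i /=; rewrite ?NegzE ?mulrNz ?fmodV fmodX.
Qed.

Local Notation pact := (pact (comm_act x) (comm_act y)).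

Lemma act_polyE t f : t \in G^`(1) ->
  act_poly x y t f = fmval (pact (fmod t) f).
Proof.
move=> G't; rewrite /act_poly /pact fmval_sum; apply: eq_bigr => mu _.
rewrite /mono_act -!fmod_iter_comm // ?mem_iter_comm //.
by rewrite -fmod_expgz ?[RHS]fmodK ?mem_expgz ?mem_iter_comm.
Qed.

Let a := fmod [~ y, x].
Let G'a : [~ y, x] \in G^`(1). Proof. exact: mem_commg. Qed.

Lemma annihilatorP f : annihilator x y f <-> pact a f = 0%R.
Proof.
rewrite /annihilator act_polyE //; split=> [f0 | -> //].
exact: val_inj.
Qed.

(** The values on a form a subgroup that is stable under conjugation by the
    generators x and y, hence contains the normal closure of [y, x]; modulo
    that closure x and y commute, so it is the derived subgroup. *)
Lemma pact_onto u : exists f, pact a f = u.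
Proof.
pose is_value t := exists2 f, pact a f = fmod t & t \in G^`(1).
suff all_values : forall t, t \in G^`(1) -> is_value t.
  by have [f ? _] := all_values _ (fmodP u); exists f; rewrite -[u]fmvalK.
pose N := <<[~ y, x] ^: G>>%G.
have sG'N : G^`(1) \subset N.
  have nNG : G \subset 'N(N) by rewrite norms_gen ?class_norm.
  apply: der1_min => //; rewrite -defG in nNG *.
  rewrite quotient_gen ?abelian_gen; last first.
    exact: subset_trans (subset_gen _) nNG.
  have [nNx nNy] : x \in 'N(N) /\ y \in 'N(N).
    by split; apply: (subsetP nNG); rewrite mem_gen ?set21 ?set22.
  have cxy : coset N x * coset N y = coset N y * coset N x.
    have := coset_kerr (x * y) (mem_gen (class_refl G [~ y, x])).
    by rewrite -commgC !morphM.
  rewrite /quotient morphimU !morphim_set1 //.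
  apply/centsP=> _ /set2P[]-> _ /set2P[]->; by [].
move=> _ /(subsetP sG'N)/gen_prodgP[n [c Vc ->]].
have value1 : is_value 1 by exists 0%R; rewrite ?raddf0 ?fmod1.
have valueM t v : is_value t -> is_value v -> is_value (t * v).
  case=> f af G't [h ah G'v]; exists (f + h)%R; last exact: groupM.
  by rewrite raddfD /= af ah fmodM.
have valueJ t g : is_value t -> g \in [set x; y] -> is_value (t ^ g).
  case=> f af G't xy_g; have Gg : g \in G by rewrite -defG mem_gen.
  rewrite conjg_mulR; apply: valueM; first by exists f.
  have G'tg := mem_comm G't Gg.
  case/set2P: xy_g => def_g; rewrite def_g in Gg G'tg *.
    exists (pX * f)%R => //.
    by rewrite (pactM comm_actC) pact_pX af /= fmod_comm.
  exists (pY * f)%R => //.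
  by rewrite (pactM comm_actC) pact_pY af /= fmod_comm.
elim/big_ind: _ => // i _; have /imsetP[g Gg ->] := Vc i.
move: Gg; rewrite -defG => /gen_prodgP[k [d xy_d ->]].
elim: k d xy_d => [|k IHk] d xy_d.
  by rewrite big_ord0 conjg1; exists 1%R; rewrite ?pact1.
by rewrite big_ord_recr conjgM; apply: valueJ => //; apply: IHk.
Qed.

End CommutatorModule.

(** * Comparing the annihilator with a presentation *)

Lemma card_abelian_type (gT : finGroupType) (A : {group gT}) :
  abelian A -> #|A| = (\prod_(i <- abelian_type A) i)%N.
Proof.
move=> abA; have [gs defA <-] := abelian_structure abA.
by rewrite big_map -(bigdprod_card defA).
Qed.

Lemma card_der1_type33 (gT : finGroupType) (G : {group gT}) n :
    abelian_type (G / G^`(1)) = [:: 3; 3] -> #|G| = (3 ^ n)%N -> (2 <= n)%N ->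
  #|G^`(1)| = (3 ^ (n - 2))%N.
Proof.
move=> type33 cardG n_ge2.
have := Lagrange (der_sub 1 G); rewrite -card_quotient; last first.
  exact/normal_norm/der_normal.
have abQ : abelian (G / G^`(1)) := der_abelian 0 G.
rewrite (card_abelian_type abQ) [abelian_type _]type33 !big_cons big_nil cardG.
rewrite -[n in RHS](subnK n_ge2) expnD => /eqP; rewrite eqn_pmul2r //.
by move/eqP.
Qed.

Section Presentation.
Local Open Scope ring_scope.

(** With a = b = c = 0 this generates R_(mu, nu); the other cases deform it by
    multiples of the socle generator X ^ (mu - 1). *)
Definition presentation (mu nu : nat) (a b c : int) : seq ZXY :=
  [:: pX ^+ mu;
      pY ^+ nu - a *: pX ^+ mu.-1;
      pX * pY - b *: pX ^+ mu.-1;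
      pT + c *: pX ^+ mu.-1].

Lemma scale_mulrz (z : int) (f : ZXY) : z *: f = f *~ z.
Proof. by rewrite -[z in LHS]intz scaler_int. Qed.

(** Let p = X ^ (mu - 1).  Replacing X Y by b p in p Y = X ^ (mu - 2) X Y leaves
    b X ^ (2 mu - 3), which is a multiple of X ^ mu as soon as mu >= 3. *)
Lemma presentation_socle mu nu (a b c : int) :
    (1 < mu)%N -> b = 0 \/ (2 < mu)%N ->
  ideal_gen (presentation mu nu a b c) (pX ^+ mu.-1 * pY).
Proof.
case: mu => [|[|mu]] //= _ b0_or_mu.
have ->: pX ^+ mu.+1 * pY
         = pX ^+ mu * (pX * pY - b *: pX ^+ mu.+1)
           + b *: (pX ^+ mu * pX ^+ mu.+1).
  by rewrite mulrBr -scalerAr subrK mulrA -exprSr.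
apply: ideal_genD.
  by apply/ideal_genM/ideal_gen_mem; rewrite !inE eqxx ?orbT.
case: b0_or_mu => [-> | mu_gt0]; first by rewrite scale0r; apply: ideal_gen0.
rewrite scale_mulrz -mulrzl -(prednK mu_gt0) exprSr -!mulrA -exprS.
by do 2!apply: ideal_genM; apply: ideal_gen_mem; rewrite inE prednK ?eqxx.
Qed.

Lemma ideal_gen_sub_annihilator (gT : finGroupType) (G : {group gT}) (x y : gT)
    gs f :
    abelian G^`(1) -> <<[set x; y]>> = G :> {set gT} ->
    {in gs, forall g, annihilator x y g} -> ideal_gen gs f -> annihilator x y f.
Proof.
move=> abG' defG gs0 If; apply/(annihilatorP abG' defG).
apply: ideal_gen_sub_kernel If => [g h g0 | g /gs0]; last first.
  by move/(annihilatorP abG' defG).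
by rewrite /= (pactM (comm_actC defG)) [pact _ _ _ g]g0 pact0r.
Qed.

(** The order of G' is the number of normal forms modulo the ideal, so the ideal
    cannot be smaller than the annihilator that contains it. *)
Lemma annihilator_presentation (gT : finGroupType) (G : {group gT}) (x y : gT)
    mu nu (a b c : int) (I := presentation mu nu a b c) :
    abelian G^`(1) -> <<[set x; y]>> = G :> {set gT} ->
    #|G^`(1)%g| = (3 ^ (mu + nu).-1)%N -> (1 < mu)%N -> b = 0 \/ (2 < mu)%N ->
    {in I, forall g, annihilator x y g} ->
  same_ideal (annihilator x y) (ideal_gen I).
Proof.
move=> abG' defG cardG' mu_gt1 b0_or_mu I_ann f.
split; last exact: ideal_gen_sub_annihilator abG' defG I_ann.
have socle := presentation_socle nu a c mu_gt1 b0_or_mu.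
have [I0 IB IM] := And3 (ideal_gen0 I) (@ideal_genB I) (@ideal_genM I).
have [I_X I_Y I_XY I_T] :
  [/\ ideal_gen I (pX ^+ mu), ideal_gen I (pY ^+ nu - pX ^+ mu.-1 *~ a),
      ideal_gen I (pX * pY - pX ^+ mu.-1 *~ b)
    & ideal_gen I (pT + pX ^+ mu.-1 *~ c)].
  by split; apply: ideal_gen_mem; rewrite !inE -?scale_mulrz eqxx ?orbT.
pose vs := normal_basis pX pY mu nu 0.
have chain_vs : ternary_chain (ideal_gen I) vs.
  exact: (chain_normal_basis I0 IB IM mu_gt1 I_X I_Y I_XY socle I_T).
have span_vs g : span_mod (ideal_gen I) vs g.
  rewrite [g]mpolyE; elim/big_ind: _ => [|h h'|m _].
  - exact: span_mod_ideal.
  - exact: span_modD.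
  rewrite scale_mulrz; apply: span_modMz => //.
  have ->: 'X_[m] = pX ^+ m ord0 * pY ^+ m ord_max :> ZXY.
    rewrite mpolyXE_id big_ord_recl big_ord1; congr (_ * 'X_ _ ^+ m _);
    exact: val_inj.
  case: (posnP (m ord0)) => [->|X_m].
    rewrite mul1r; exact: (span_Yn I0 IB IM mu_gt1 I_X I_Y I_XY socle).
  exact: (span_XnYn I0 IB IM nu mu_gt1 I_X I_XY socle).
move/(annihilatorP abG' defG) => f0.
apply: (ternary_kernel I0 IB chain_vs span_vs (@pact_onto _ _ _ _ abG' defG)).
- move=> u v Iuv; apply/eqP; rewrite -subr_eq0 -raddfB; apply/eqP.
  apply/(annihilatorP abG' defG).
  exact: ideal_gen_sub_annihilator abG' defG I_ann Iuv.
- by rewrite card_sub size_normal_basis // -cardG'; apply: eq_card.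
by rewrite f0 raddf0.
Qed.

End Presentation.

(** * The relations of the representative, read in the module *)

Section Representative.

Import FiniteModule.

Variables (gT : finGroupType) (G : {group gT}) (x y : gT).
Variables (m e s k : nat) (alpha beta gamma delta rho : int).
Hypotheses (m_ge4 : 4 <= m) (e_ge3 : 3 <= e) (k_le1 : k <= 1).
(* The relations s_i = sigma_i^-1 sigma_(i+1)^-1 start at i = 5, so that
   s_(m-1) = sigma_(m-1)^-1 needs m >= 6; for rho = 0 all the multiples of it
   that occur vanish. *)
Hypotheses (rho0_or_m : rho = 0%R \/ 6 <= m) (abG' : abelian G^`(1)).
Hypothesis norm_xy : normalized_generators G m s x y.
Hypothesis rep_xy : representative G m e k alpha beta gamma delta rho x y.

Local Notation fmod := (fmod abG').
Local Notation a := (fmod [~ y, x]).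
Local Notation pact := (pact (comm_act x) (comm_act y)).
Local Notation Z := (fmod (sigma_ x y m.-1)).

Let defG := Defs.norm_gen norm_xy.
Let Gx : x \in G. Proof. by have [] := norm_x norm_xy. Qed.
Let Gy : y \in G. Proof. by rewrite -defG mem_gen ?set22. Qed.
Let G'a : [~ y, x] \in G^`(1). Proof. exact: mem_commg. Qed.

Let sL3G' : 'L_3(G) \subset G^`(1). Proof. exact: lcn_subS. Qed.
Let G'x3 : x ^+ 3 \in G^`(1).
Proof.
by rewrite (subsetP sL3G') // (norm_gamma3 norm_xy) mem_gen // !inE eqxx orbT.
Qed.
Let G'y3 : y ^+ 3 \in G^`(1).
Proof.
by rewrite (subsetP sL3G') // (norm_gamma3 norm_xy) mem_gen // !inE eqxx.
Qed.

Let G's i : s_ x y i \in G^`(1). Proof. exact: mem_iter_comm. Qed.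
Let G't i : t_ x y i \in G^`(1). Proof. exact: mem_iter_comm. Qed.
Let G'sigma i : sigma_ x y i \in G^`(1). Proof. exact: mem_iter_comm. Qed.
Let G'tau i : tau_ x y i \in G^`(1). Proof. exact: mem_iter_comm. Qed.

Lemma pact_s i : pact a (pX ^+ i) = fmod (s_ x y i.+2).
Proof.
rewrite (pact_pXn (comm_actC defG)) /= -fmod_iter_comm //.
by rewrite /s_ !subSS subn0.
Qed.

Lemma pact_t i : pact a (pY ^+ i) = fmod (t_ x y i.+2).
Proof.
rewrite (pact_pYn (comm_actC defG)) /= -fmod_iter_comm //.
by rewrite /t_ !subSS subn0.
Qed.

Lemma pact_Xn_nilpotent : pact a (pX ^+ (m - 2)) = 0%R.
Proof.
rewrite pact_s; have ->: (m - 2).+2 = m by lia.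
have sig1 := rep_sigma_eq1 rep_xy.
case: rho0_or_m => [rho0 | m_ge6]; last first.
  by rewrite (rep_s_sigma rep_xy) ?sig1 ?invg1 ?mulg1 ?fmod1 // ltnW.
move: m_ge4; rewrite leq_eqVlt => /predU1P[m4 | m_ge5].
  have [] := rep_second rep_xy; rewrite rho0 mul0r [sigma_ x y 4]sig1 -?m4 //.
  by rewrite [sigma_ x y 5]sig1 -?m4 // !mulg1 => -> _ _; rewrite fmod1.
by rewrite (rep_s_sigma rep_xy) ?sig1 ?invg1 ?mulg1 ?fmod1.
Qed.

Lemma pact_socle : 6 <= m -> pact a (pX ^+ (m - 3)) = (- Z)%R.
Proof.
move=> m_ge6; rewrite pact_s; have ->: (m - 3).+2 = m.-1 by lia.
rewrite (rep_s_sigma rep_xy); last by lia.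
by rewrite (rep_sigma_eq1 rep_xy (i := m.-1.+1)) ?invg1 ?mulg1 ?fmodV //; lia.
Qed.

Lemma pact_socle_rho : (pact a (pX ^+ (m - 3)) *~ rho = - (Z *~ rho))%R.
Proof.
case: rho0_or_m => [->|m_ge6]; first by rewrite !mulr0z oppr0.
by rewrite pact_socle // mulNrz.
Qed.

Lemma pact_XY : pact a (pX * pY)%R = (- (Z *~ (rho * delta)))%R.
Proof.
have [] := rep_XY rep_xy; rewrite (act_polyE abG' defG) // => XY _ _.
apply: val_inj; rewrite [LHS]XY /=.
by rewrite -mulrNz -fmod_expgz // [RHS]fmodK // mem_expgz.
Qed.

Lemma pact_T : pact a pT = (Z *~ (rho * beta))%R.
Proof.
have fmod_T t2 t3 t4 t3' t4' : t2 \in G^`(1) -> t3 \in G^`(1) ->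
    t4 \in G^`(1) -> t3' \in G^`(1) -> t4' \in G^`(1) ->
  fmod (t2 ^+ 3 * (t3 * t3') ^+ 3 * t4 * t4')
  = (fmod t2 *+ 3 + (fmod t3 *+ 3 + fmod t3' *+ 3) + fmod t4 + fmod t4')%R.
  move=> *; rewrite -mulrnDl -[(fmod t3 + _)%R]fmodM // -!fmodX ?groupM //.
  by rewrite -!fmodM ?groupM ?groupX ?groupM.
rewrite -fmod_expgz // -(rep_T rep_xy) fmod_T //.
have pact3 f : pact a (3%:R * f)%R = (pact a f *+ 3)%R.
  by rewrite mulr_natl raddfMn.
have ->: (pT = pX ^+ 2 + 3%:R * pX ^+ 1 + 3%:R * 1
                + 3%:R * pY ^+ 1 + pY ^+ 2)%R.
  by rewrite mulr1.
rewrite !raddfD /= !pact3 !pact_s !pact_t pact1.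
by rewrite [LHS](ACl (3*(2*4)*1*5))%R.
Qed.

(** For e >= 4 the element t_(e+1) is tau_(e+1); for e = 3 it is t_4, to which
    the second central relations contribute sigma_(m-1)^(rho beta) as well. *)
Definition Y_coef : int := (if e == 3 then (1 - beta) * rho else rho)%R.

Lemma pact_Y : pact a (pY ^+ (e - 1)) = (- (Z *~ Y_coef))%R.
Proof.
have tau0 : tau_ x y e.+2 = 1.
  by rewrite (rep_tau_eq1 rep_xy) //; lia.
have tau1 : fmod (tau_ x y e.+1) = (- (Z *~ rho))%R.
  by rewrite (rep_tau rep_xy) fmod_expgz // mulrNz.
rewrite pact_t; have ->: (e - 1).+2 = e.+1 by lia.
rewrite /Y_coef; case: eqP => [e3 | /eqP e_neq3].
  have [_ t4 _] := rep_second rep_xy.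
  have {t4} : t_ x y 4 = expgz (sigma_ x y m.-1) (rho * beta)%R
                          * tau_ x y 5 * tau_ x y 4.
    by rewrite -t4 !mulgKV.
  rewrite e3 in tau0 tau1 *; rewrite tau0 mulg1 => ->.
  rewrite fmodM ?mem_expgz // fmod_expgz // tau1 -mulrNz -mulrzDr -mulrNz.
  by congr (_ *~ _)%R; ring.
rewrite (rep_t_tau rep_xy); last by lia.
by rewrite tau0 mulg1.
Qed.

Lemma representative_annihilated :
  {in presentation (m - 2) (e - 1) Y_coef (rho * delta) (rho * beta),
    forall g, annihilator x y g}.
Proof.
have rhoC (c : int) :
  (pact a (pX ^+ (m - 2).-1) *~ (rho * c) = - (Z *~ (rho * c)))%R.
  by rewrite -subn1 -subnDA !mulrzA pact_socle_rho mulNrz.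
have Y_coefE : Y_coef = (rho * (if e == 3 then 1 - beta else 1))%R.
  by rewrite /Y_coef; case: ifP => _; ring.
move=> g; rewrite !inE => g_gen; apply/(annihilatorP abG' defG).
case/or4P: g_gen => /eqP->; first exact: pact_Xn_nilpotent.
- by rewrite raddfB /= pactZ pact_Y Y_coefE rhoC subrr.
- by rewrite raddfB /= pactZ pact_XY rhoC subrr.
by rewrite raddfD /= pactZ pact_T rhoC subrr.
Qed.

(** The relation sigma_(m-1)^3 sigma_m^3 sigma_(m+1) = 1 gives sigma_(m-1)
    order 3, and X ^ (m - 3) sends s_2 to the inverse of sigma_(m-1). *)
Lemma socle_coef_dvd3 c : 6 <= m ->
  annihilator x y (c *: pX ^+ (m - 3))%R -> (c %% 3)%Z = 0%R.
Proof.
move=> m_ge6 /(annihilatorP abG' defG); rewrite pactZ pact_socle // => Zc.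
have Z3 : (Z *~ 3 = 0)%R.
  have := rep_sigma3 rep_xy (i := m.-1).
  rewrite (rep_sigma_eq1 rep_xy (i := m.-1.+1)); last by lia.
  rewrite (rep_sigma_eq1 rep_xy (i := m.-1.+2)); last by lia.
  rewrite expg1n !mulg1 => sig3.
  by rewrite -[LHS]fmodX // sig3 ?fmod1 //; lia.
have {}Zc : (Z *~ c = 0)%R.
  by apply/eqP; rewrite -oppr_eq0 -mulNrz; apply/eqP.
case: (eqVneq (c %% 3)%Z 0%R) => // c_neq0.
have [u [v uv1]] : exists u v : int, (c * u + 3 * v = 1)%R.
  case: (eqVneq (c %% 3)%Z 1%R) => c1.
    by exists 1%R, (- (c %/ 3)%Z)%R; lia.
  by exists (-1)%R, ((c %/ 3)%Z + 1)%R; lia.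
have Z0 : Z = 0%R.
  by rewrite -[LHS]mulr1z -uv1 mulrzDr !mulrzA Zc Z3 !mul0rz addr0.
have m_range : 3 <= m.-1 <= m.-1 by lia.
case/eqP: (rep_sigma_neq1 rep_xy m_range).
by rewrite -[LHS](fmodK abG') // [fmod _]Z0.
Qed.

End Representative.

Lemma unit_trit_mod3 (r c d : int) :
    (r = 1 \/ r = -1)%R -> c \in [:: -1; 0; 1]%R -> d \in [:: -1; 0; 1]%R ->
  ((r * c - r * d) %% 3)%Z = 0%R -> c = d.
Proof.
by case=> ->; rewrite !inE => /or3P[]/eqP-> /or3P[]/eqP->.
Qed.

Theorem theorem4p1 (gT : finGroupType) (G : {group gT}) (x y : gT)
    (m n e s k : nat) (alpha beta gamma delta rho : int)
    (G_metabelian : abelian G^`(1))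
    (G_3group : 3.-group G)
    (G_type33 : abelian_type (G / G^`(1)) = [:: 3; 3])
    (G_order : #|G| = (3 ^ n)%N) (n_ge5 : 5 <= n)
    (G_class : nil_class G = m.-1) (m_ge4 : 4 <= m)
    (e_inv : is_CF_invariant G e) (e_eq : e = n - m + 2)
    (e_bounds : 3 <= e <= m.-1) (n_bounds : (m + 1 <= n <= 2 * m - 3)%N)
    (s_inv : is_s_invariant G m s)
    (k_defect : is_defect G m e s k)
    (alphaP : alpha \in [:: -1; 0; 1]%R) (betaP : beta \in [:: -1; 0; 1]%R)
    (gammaP : gamma \in [:: -1; 0; 1]%R) (deltaP : delta \in [:: -1; 0; 1]%R)
    (rhoP : rho \in [:: -1; 0; 1]%R)
    (xy_normalized : normalized_generators G m s x y)
    (xy_rep : representative G m e k alpha beta gamma delta rho x y) :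
  [/\ k = 0 ->
        same_ideal (annihilator x y) (idealR (m - 2) (e - 1)),
      k = 1%N -> 6 <= m -> 4 <= e ->
        same_ideal (annihilator x y) (idealS (m - 2) (e - 1) beta delta rho)
        (* genuine dependence on each of beta, delta, rho *)
        /\ forall z : int, z \in [:: -1; 0; 1]%R ->
           [/\ z <> beta ->
                 ~ same_ideal (annihilator x y)
                     (idealS (m - 2) (e - 1) z delta rho),
               z <> delta ->
                 ~ same_ideal (annihilator x y)
                     (idealS (m - 2) (e - 1) beta z rho)
             & z <> rho ->
                 ~ same_ideal (annihilator x y)
                     (idealS (m - 2) (e - 1) beta delta z)]
    & k = 1%N -> 6 <= m -> e = 3 ->
        same_ideal (annihilator x y)
          (ideal_gen [:: pX ^+ (m - 2);
                         pY ^+ 2 - ((1 - beta) * rho) *: pX ^+ (m - 3);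
                         pX * pY - (rho * delta) *: pX ^+ (m - 3);
                         pT + (rho * beta) *: pX ^+ (m - 3)])%R].
Proof.
have k_le1 : k <= 1 by case: k_defect.
have [e_ge3 _] := andP e_bounds.
have [[k0 _] [k1 _]] := rep_defect xy_rep.
have defG : <<[set x; y]>> = G := Defs.norm_gen xy_normalized.
have annihilatorE : rho = 0%R \/ 6 <= m ->
    same_ideal (annihilator x y)
      (ideal_gen (presentation (m - 2) (e - 1) (Y_coef e beta rho)
                               (rho * delta) (rho * beta))).
  move=> rho0_or_m; apply: (annihilator_presentation G_metabelian defG).
  - rewrite (card_der1_type33 G_type33 G_order); last by lia.
    by congr (3 ^ _)%N; lia.
  - by lia.
  - by case: rho0_or_m => [-> | ?]; [left; rewrite mul0r | right; lia].
  exact: (representative_annihilated m_ge4 e_ge3 k_le1 rho0_or_m G_metabelian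
    xy_normalized xy_rep).
split=> [k_eq0 | k_eq1 m_ge6 e_ge4 | k_eq1 m_ge6 e_eq3].
- have rho0 := k0 k_eq0; have := annihilatorE (or_introl rho0).
  rewrite /presentation rho0 /Y_coef mulr0 if_same !mul0r !scale0r !subr0 addr0.
  exact.
- have same := annihilatorE (or_intror m_ge6).
  have e_neq3 : (e == 3) = false by lia.
  have annS : same_ideal (annihilator x y)
                         (idealS (m - 2) (e - 1) beta delta rho).
    by move: same; rewrite /Y_coef e_neq3.
  split=> // z z_range.
  have separate (f : ZXY) c d : annihilator x y (f + c *: pX ^+ (m - 2).-1)%R ->
      annihilator x y (f + d *: pX ^+ (m - 2).-1)%R -> ((c - d) %% 3)%Z = 0%R.
    move=> fc fd; apply: (socle_coef_dvd3 m_ge4 e_ge3 k_le1 (or_intror m_ge6)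
                            G_metabelian xy_normalized xy_rep) => //.
    have -> : ((c - d) *: pX ^+ (m - 3) = (f + c *: pX ^+ (m - 2).-1)
                                        - (f + d *: pX ^+ (m - 2).-1))%R.
      by rewrite opprD addrACA subrr add0r scalerBl -subn1 -subnDA.
    by apply/same/ideal_genB; apply/same.
  have gen_ann b d r (I := idealS (m - 2) (e - 1) b d r) :
      same_ideal (annihilator x y) I ->
      [/\ annihilator x y (pY ^+ (e - 1) + (- r) *: pX ^+ (m - 2).-1)%R,
          annihilator x y (pX * pY + (- (r * d)) *: pX ^+ (m - 2).-1)%R
        & annihilator x y (pT + (r * b) *: pX ^+ (m - 2).-1)%R].
    move=> annI; split; apply/annI/ideal_gen_mem;
    by rewrite ?scaleNr !inE eqxx ?orbT.
  have [annY annXY annT] := gen_ann _ _ _ annS.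
  have rho_pm1 : rho = 1%R \/ rho = (-1)%R by apply: k1.
  split=> z_neq /gen_ann[annY' annXY' annT']; apply: z_neq.
  + exact: unit_trit_mod3 rho_pm1 z_range betaP (separate _ _ _ annT' annT).
  + apply: unit_trit_mod3 rho_pm1 z_range deltaP _.
    by have := separate _ _ _ annXY annXY'; rewrite opprK addrC.
  apply: (@unit_trit_mod3 1) => //; first by left.
  by have := separate _ _ _ annY annY'; rewrite opprK addrC !mul1r.
have := annihilatorE (or_intror m_ge6).
rewrite /presentation /Y_coef e_eq3 eqxx.
by have -> : (m - 2).-1 = m - 3 by lia.
Qed.
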